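(* Let $(X,\tau)$ be a locally compact Hausdorff space. Then there exists an isomorphism $\mu$ between the posets $(\mathcal{L}(X),\le)$ and $(\mathcal{L}_a(X),\preceq_l)$.
   Context: Boolean algebras are not required to satisfy $0\neq 1$; the complement of $a$ is written $a^*$. For a topological space $X$, $RC(X)$ is the complete Boolean algebra of all regular closed subsets ($F=\mathrm{cl}(\mathrm{int}(F))$), with $0=\emptyset$, $1=X$, $F^*=\mathrm{cl}(X\setminus F)$, $F\vee G=F\cup G$, $F\wedge G=\mathrm{cl}(\mathrm{int}(F\cap G))$; $CR(X)$ is the set of compact regular closed subsets. A contact algebra (CA) $(B,C)$ is a Boolean algebra $B$ with a binary relation $C$ such that: (C1) $a\ne 0$ implies $aCa$; (C2) $aCb$ implies $a\neq 0$ and $b\ne 0$; (C3) $aCb$ implies $bCa$; (C4) $aC(b\vee c)$ iff $aCb$ or $aCc$. Write $a\ll_C b$ iff not $aCb^*$. A local contact algebra (LCA) $(B,\rho,\mathbb{B})$ consists of a CA $(B,\rho)$ and a (possibly non-proper) ideal $\mathbb{B}$ of $B$ such that: (BC1) if $a\in\mathbb{B}$, $c\in B$, $a\ll_\rho c$, then $a\ll_\rho b\ll_\rho c$ for some $b\in\mathbb{B}$; (BC2) if $a\rho b$ then there is $c\in\mathbb{B}$ with $a\rho(c\wedge b)$; (BC3) if $a\neq 0$ then there is $b\in\mathbb{B}\setminus\{0\}$ with $b\ll_\rho a$. A locally compact Hausdorff extension of $X$ is a pair $(Y,f)$ with $Y$ locally compact Hausdorff and $f:X\to Y$ a homeomorphic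 embedding with dense image; $(Y_1,f_1),(Y_2,f_2)$ are equivalent if there is a homeomorphism $h:Y_1\to Y_2$ with $h\circ f_1=f_2$. $\mathcal{L}(X)$ is the set of equivalence classes, ordered by $[(Y_1,f_1)]\le[(Y_2,f_2)]$ iff there is a continuous $h:Y_2\to Y_1$ with $f_1=h\circ f_2$. For $X$ locally compact Hausdorff, $\mathcal{L}_a(X)$ is the set of all LCAs of the form $(RC(X),\rho,\mathbb{B})$ such that: (LA1) for all $F,G\in RC(X)$, $F\cap G\ne\emptyset$ implies $F\rho G$; (LA2) $CR(X)\subseteq\mathbb{B}$; (LA3) for all $F\in RC(X)$ and $G\in CR(X)$, $F\rho G$ implies $F\cap G\neq\emptyset$. It is ordered by $(RC(X),\rho_1,\mathbb{B}_1)\preceq_l(RC(X),\rho_2,\mathbb{B}_2)$ iff $\rho_2\subseteq\rho_1$ and $\mathbb{B}_2\subseteq\mathbb{B}_1$. *)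

(* Defs.v *)
From HB Require Import structures.
From mathcomp Require Import all_boot all_order.
From mathcomp Require Import boolp classical_sets functions filter topology.

Set Implicit Arguments.
Unset Strict Implicit.
Unset Printing Implicit Defensive.

Import Order.TTheory.

Local Open Scope classical_set_scope.

(* A [ctbDistrLatticeType] is a Boolean algebra, possibly with one element. *)
Section ContactAlgebras.
Context {d : Order.disp_t} {B : ctbDistrLatticeType d}.

Record contact_algebra (C : B -> B -> Prop) : Prop := ContactAlgebra {
  contact_refl : forall a, a <> \bot%O -> C a a;
  contact_neq0 : forall a b, C a b -> a <> \bot%O /\ b <> \bot%O;
  contact_sym : forall a b, C a b -> C b a;
  contact_join : forall a b c, C a (b `|` c)%O <-> C a b \/ C a c }.

Definition nontangential (C : B -> B -> Prop) (a b : B) : Prop :=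
  ~ C a (~` b)%O.

Record lattice_ideal (I : set B) : Prop := LatticeIdeal {
  ideal0 : I \bot%O;
  ideal_le : forall a b, (a <= b)%O -> I b -> I a;
  ideal_join : forall a b, I a -> I b -> I (a `|` b)%O }.

Record local_contact_algebra (rho : B -> B -> Prop) (I : set B) : Prop :=
  LocalContactAlgebra {
  lca_contact : contact_algebra rho;
  lca_ideal : lattice_ideal I;
  lca_interp : forall a c, I a -> nontangential rho a c ->
    exists2 b, I b & nontangential rho a b /\ nontangential rho b c;
  lca_local : forall a b, rho a b -> exists2 c, I c & rho a (c `&` b)%O;
  lca_dense : forall a, a <> \bot%O ->
    exists b, [/\ I b, b <> \bot%O & nontangential rho b a] }.

End ContactAlgebras.

Record RC (X : topologicalType) := MkRC {
  rcset :> set X;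
  rcsetP : regclosed rcset }.

Section RegularClosed.
Context {X : topologicalType}.
Implicit Types (F G H : RC X) (A B : set X).

Lemma rc_ext F G : F = G :> set X -> F = G.
Proof.
case: F G => [A hA] [B hB] /= eAB; case: _ / eAB hB => hB.
by congr MkRC; exact: Prop_irrelevance.
Qed.

Lemma rc_closed F : closed F.
Proof. by rewrite -(rcsetP F); exact: closed_closure. Qed.

Lemma regclosed_setU F G : regclosed (F `|` G).
Proof.
have cFG : closed (F `|` G) by apply: closedU; exact: rc_closed.
apply/seteqP; split.
  apply: subset_trans (closureS (@interior_subset _ _)) _.
  by rewrite -(closure_id _).1.
rewrite -{1}(rcsetP F) -{1}(rcsetP G) -closureU.
exact/closureS/interiorU.
Qed.

Lemma regclosed_meet A : regclosed (closure A°).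
Proof. exact/closure_open_regclosed/open_interior. Qed.

Lemma regclosed_compl F : regclosed (closure (~` F)).
Proof. exact/closure_open_regclosed/closed_openC/rc_closed. Qed.

Lemma regclosed_set0 : regclosed (@set0 X).
Proof. by rewrite /regclosed interior0 closure0. Qed.

Lemma regclosed_setT : regclosed [set: X].
Proof. by rewrite /regclosed interiorT closureT. Qed.

Definition rc_join F G := MkRC (regclosed_setU F G).
Definition rc_meet F G := MkRC (regclosed_meet (F `&` G)).
Definition rc_compl F := MkRC (regclosed_compl F).
Definition rc_bot := MkRC regclosed_set0.
Definition rc_top := MkRC regclosed_setT.
Definition rc_le F G : bool := `[< F `<=` G >].

HB.instance Definition _ := gen_eqMixin (RC X).
HB.instance Definition _ := gen_choiceMixin (RC X).

Fact rc_display : Order.disp_t. Proof. exact: Order.Disp tt tt. Qed.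

Lemma rc_le_refl : reflexive rc_le.
Proof. by move=> F; apply/asboolP. Qed.

Lemma rc_le_anti : antisymmetric rc_le.
Proof.
by move=> F G /andP[/asboolP FG /asboolP GF]; apply/rc_ext/seteqP.
Qed.

Lemma rc_le_trans : transitive rc_le.
Proof.
move=> G F H /asboolP FG /asboolP GH.
by apply/asboolP; exact: subset_trans GH.
Qed.

HB.instance Definition _ :=
  Order.Le_isPOrder.Build rc_display (RC X) rc_le_refl rc_le_anti rc_le_trans.

Lemma rc_leP F G : reflect (F `<=` G) (F <= G)%O.
Proof. exact: asboolP. Qed.

Lemma rc_meetP F G H : (F <= rc_meet G H)%O = (F <= G)%O && (F <= H)%O.
Proof.
apply/rc_leP/andP => [FGH|[/rc_leP FG /rc_leP FH]].
  have sub (K : RC X) : G `&` H `<=` K -> (F <= K)%O.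
    move=> GHK; apply/rc_leP; apply: (subset_trans FGH).
    by rewrite -[X in _ `<=` X](rcsetP K); exact/closureS/interiorS.
  by split; apply: sub; [exact: subIsetl | exact: subIsetr].
by rewrite -(rcsetP F); apply/closureS/interiorS; rewrite subsetI.
Qed.

Lemma rc_joinP F G H : (rc_join F G <= H)%O = (F <= H)%O && (G <= H)%O.
Proof.
apply/rc_leP/andP => [/=|[/rc_leP FH /rc_leP GH]].
  by rewrite subUset => -[FH GH]; split; apply/rc_leP.
by rewrite /= subUset.
Qed.

HB.instance Definition _ :=
  Order.POrder_MeetJoin_isLattice.Build rc_display (RC X) rc_meetP rc_joinP.

Lemma interior_setU_closed A B : closed A ->
  (A `|` B)° `<=` closure A° `|` closure B°.
Proof.
move=> cA x ABx; have [|nAx] := pselect (closure A° x); first by left.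
right=> U Ux; pose W := U° `&` ((A `|` B)° `&` (~` A°)°).
have oW : open W by do 2?[apply: openI]; exact: open_interior.
have Wx : W x by do 2?[split=> //]; rewrite interiorC.
have [y [Wy nAy]] : (W `\` A) !=set0.
  apply/set0P/eqP; rewrite setD_eq0 open_subsetE// => WA.
  by apply: nAx; apply: subset_closure; exact: WA.
have [Uy _] := Wy; exists y; split; last exact: interior_subset.
have oWA : open (W `\` A) by apply: openI => //; exact: closed_openC.
suff : W `\` A `<=` B° by apply; split.
by rewrite -open_subsetE// => z [[_ [/interior_subset[]]]].
Qed.

Lemma rc_meetUl : left_distributive rc_meet rc_join.
Proof.
move=> F G H; apply/rc_ext => /=; rewrite setIUl; apply/seteqP; split.
  apply: (subset_trans (closureS (interior_setU_closed _))).
    by apply: closedI; exact: rc_closed.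
  have clK A : closure (closure A) = closure A.
    by rewrite -(closure_id _).1//; exact: closed_closure.
  by rewrite closureU !clK.
by rewrite -closureU; exact/closureS/interiorU.
Qed.

HB.instance Definition _ :=
  Order.Lattice_Meet_isDistrLattice.Build rc_display (RC X) rc_meetUl.

Lemma rc_bot_le F : (rc_bot <= F)%O.
Proof. by apply/rc_leP; exact: sub0set. Qed.

Lemma rc_le_top F : (F <= rc_top)%O.
Proof. by apply/rc_leP; exact: subsetT. Qed.

HB.instance Definition _ :=
  Order.hasBottom.Build rc_display (RC X) rc_bot_le.
HB.instance Definition _ :=
  Order.hasTop.Build rc_display (RC X) rc_le_top.

Lemma rc_joinxC F : rc_join F (rc_compl F) = rc_top.
Proof.
apply/rc_ext/seteqP; split=> //= x _.
by have [Fx|nFx] := pselect (rcset F x); [left|right; exact: subset_closure].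
Qed.

Lemma rc_meetxC F : rc_meet F (rc_compl F) = rc_bot.
Proof.
apply/rc_ext => /=; rewrite closure_setC interiorI interiorC rcsetP.
rewrite (_ : _ `&` _ = set0) ?closure0// -subset0 => x [Fx nFx].
by apply: nFx; exact: interior_subset Fx.
Qed.

HB.instance Definition _ :=
  Order.TBDistrLattice_hasComplement.Build rc_display (RC X)
    rc_joinxC rc_meetxC.

Lemma rc_botE : (\bot : RC X)%O = set0 :> set X. Proof. by []. Qed.
Lemma rc_topE : (\top : RC X)%O = setT :> set X. Proof. by []. Qed.
Lemma rc_joinE F G : (F `|` G)%O = F `|` G :> set X. Proof. by []. Qed.
Lemma rc_meetE F G : (F `&` G)%O = closure (F `&` G)° :> set X.
Proof. by []. Qed.
Lemma rc_complE F : (~` F)%O = closure (~` F) :> set X. Proof. by []. Qed.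

End RegularClosed.

Definition CR (X : topologicalType) : set (RC X) := [set F | compact F].
Arguments CR : clear implicits.

Definition embedding (X Y : topologicalType) (f : X -> Y) : Prop :=
  [/\ injective f, continuous f &
      forall U, open U -> exists2 V, open V & f @` U = V `&` range f].

Definition homeomorphism (X Y : topologicalType) (h : X -> Y) : Prop :=
  continuous h /\
  exists g : Y -> X, [/\ continuous g, cancel h g & cancel g h].

Record lch_extension (X : topologicalType) := LCHExtension {
  ext_space : topologicalType;
  ext_map : X -> ext_space;
  ext_locally_compact : locally_compact [set: ext_space];
  ext_hausdorff : hausdorff_space ext_space;
  ext_embedding : embedding ext_map;
  ext_dense : dense (range ext_map) }.

Lemma continuousT_comp (X Y Z : topologicalType) (f : X -> Y) (g : Y -> Z) :
  continuous f -> continuous g -> continuous (g \o f).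
Proof. by move=> fc gc x; apply: continuous_comp; [exact: fc | exact: gc]. Qed.

Section Extensions.
Context {X : topologicalType}.
Implicit Types e : lch_extension X.

Definition ext_equiv e1 e2 : Prop :=
  exists2 h : ext_space e1 -> ext_space e2,
    homeomorphism h & h \o @ext_map X e1 = @ext_map X e2.

Definition ext_le e1 e2 : Prop :=
  exists2 h : ext_space e2 -> ext_space e1,
    continuous h & @ext_map X e1 = h \o @ext_map X e2.

Lemma ext_equiv_refl e : ext_equiv e e.
Proof.
exists id => //; split; first by move=> x; exact: cvg_id.
by exists id; split=> // x; exact: cvg_id.
Qed.

Lemma ext_equiv_sym e1 e2 : ext_equiv e1 e2 -> ext_equiv e2 e1.
Proof.
move=> [h [hc [g [gc hg gh]]] hE]; exists g.
  by split=> //; exists h; split.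
by rewrite -hE; apply/funext => x /=; rewrite hg.
Qed.

Lemma ext_equiv_trans e1 e2 e3 :
  ext_equiv e1 e2 -> ext_equiv e2 e3 -> ext_equiv e1 e3.
Proof.
move=> [h [hc [g [gc hg gh]]] hE] [k [kc [l [lc kl lk]]] kE].
exists (k \o h); last by rewrite -kE -hE.
split; first by exact: continuousT_comp.
exists (g \o l); split; first by exact: continuousT_comp.
  by move=> x /=; rewrite kl hg.
by move=> x /=; rewrite gh lk.
Qed.

Lemma ext_le_refl e : ext_le e e.
Proof. by exists id => // x; exact: cvg_id. Qed.

Lemma ext_le_trans e1 e2 e3 : ext_le e1 e2 -> ext_le e2 e3 -> ext_le e1 e3.
Proof.
move=> [h hc hE] [k kc kE]; exists (h \o k); last by rewrite hE kE.
by exact: continuousT_comp.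
Qed.

Lemma ext_equiv_le e1 e2 : ext_equiv e1 e2 -> ext_le e1 e2.
Proof.
move=> /ext_equiv_sym[h [hc _] hE]; exists h => //.
Qed.

Lemma dense_range_eq e (Z : topologicalType) (h k : ext_space e -> Z) :
  hausdorff_space Z -> continuous h -> continuous k ->
  h \o @ext_map X e = k \o @ext_map X e -> h = k.
Proof.
move=> hZ hc kc hk; apply/funext => y; apply: hZ => U V /hc Uy /kc Vy.
pose O := (h @^-1` U `&` k @^-1` V)°.
have O0 : O !=set0 by exists y; apply: filterI.
have [z [Oz [x _ xE]]] := ext_dense O0 (open_interior _).
have [Uz Vz] := interior_subset Oz.
exists (h z); split=> //; rewrite -xE in Vz *.
by move/(congr1 (@^~ x)): hk => /= ->.
Qed.

Lemma ext_le_anti e1 e2 : ext_le e1 e2 -> ext_le e2 e1 -> ext_equiv e1 e2.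
Proof.
move=> [h hc hE] [k kc kE]; exists k => //; split=> //; exists h; split=> //.
- suff : h \o k = id by move=> hk x; rewrite -[RHS](congr1 (@^~ x) hk).
  apply: (dense_range_eq (@ext_hausdorff _ e1)) => //.
  + by exact: continuousT_comp.
  + by move=> x; exact: cvg_id.
  + by rewrite -compA -kE -hE.
- suff : k \o h = id by move=> hk x; rewrite -[RHS](congr1 (@^~ x) hk).
  apply: (dense_range_eq (@ext_hausdorff _ e2)) => //.
  + by exact: continuousT_comp.
  + by move=> x; exact: cvg_id.
  + by rewrite -compA -hE -kE.
Qed.

End Extensions.

(* An equivalence class is its membership predicate; [-> Prop] is written out
   because [lch_extension X] lives one universe above the spaces themselves. *)
Record ext_class (X : topologicalType) := ExtClass {
  in_class : lch_extension X -> Prop;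
  ext_classP : exists e, in_class = ext_equiv e }.

Section ExtensionClasses.
Context {X : topologicalType}.
Implicit Types (e : lch_extension X) (c : ext_class X).

Definition class_of e : ext_class X := ExtClass (ex_intro _ e erefl).

Definition class_le c1 c2 : Prop :=
  exists e1 e2, [/\ in_class c1 e1, in_class c2 e2 & ext_le e1 e2].

Lemma class_ofP c : exists e, c = class_of e.
Proof.
case: c => P PP; have [e eP] := PP; exists e.
rewrite /class_of; move: (ex_intro _ e _); case: _ / eP => PP'.
by congr ExtClass; exact: Prop_irrelevance.
Qed.

Lemma class_of_eq e1 e2 : class_of e1 = class_of e2 <-> ext_equiv e1 e2.
Proof.
split=> [/(congr1 (@in_class X)) /= ->|e12]; first exact: ext_equiv_refl.
have E : ext_equiv e1 = ext_equiv e2.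
  apply/funext => e; apply/propext; split; last exact: ext_equiv_trans.
  exact/ext_equiv_trans/ext_equiv_sym.
rewrite /class_of; move: (ex_intro _ e1 _) (ex_intro _ e2 _).
by case: _ / E => p q; congr ExtClass; exact: Prop_irrelevance.
Qed.

Lemma class_leE e1 e2 : class_le (class_of e1) (class_of e2) <-> ext_le e1 e2.
Proof.
split=> [[f1 [f2 /= [e1f1 e2f2 f12]]]|e12]; last first.
  by exists e1, e2; split=> //=; exact: ext_equiv_refl.
apply: (ext_le_trans (ext_equiv_le e1f1)); apply: (ext_le_trans f12).
exact/ext_equiv_le/ext_equiv_sym.
Qed.

Lemma class_le_refl c : class_le c c.
Proof. by have [e ->] := class_ofP c; apply/class_leE/ext_le_refl. Qed.

Lemma class_le_trans c1 c2 c3 :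
  class_le c1 c2 -> class_le c2 c3 -> class_le c1 c3.
Proof.
have [[e1 ->] [e2 ->]] := conj (class_ofP c1) (class_ofP c2).
have [e3 ->] := class_ofP c3.
by rewrite !class_leE; exact: ext_le_trans.
Qed.

Lemma class_le_anti c1 c2 : class_le c1 c2 -> class_le c2 c1 -> c1 = c2.
Proof.
have [[e1 ->] [e2 ->]] := conj (class_ofP c1) (class_ofP c2).
by rewrite !class_leE class_of_eq; exact: ext_le_anti.
Qed.

End ExtensionClasses.

Record admissible_lca (X : topologicalType) := AdmissibleLCA {
  lca_rel : RC X -> RC X -> Prop;
  lca_bounded : set (RC X);
  lca_axioms : local_contact_algebra lca_rel lca_bounded;
  lca_meet : forall F G : RC X, F `&` G !=set0 -> lca_rel F G;
  lca_compact : CR X `<=` lca_bounded;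
  lca_compact_meet : forall F G : RC X,
    CR X G -> lca_rel F G -> F `&` G !=set0 }.

Section AdmissibleOrder.
Context {X : topologicalType}.
Implicit Types a : admissible_lca X.

Definition lca_le a1 a2 : Prop :=
  (forall F G, lca_rel a2 F G -> lca_rel a1 F G) /\
  lca_bounded a2 `<=` lca_bounded a1.

Lemma lca_le_refl a : lca_le a a.
Proof. by split. Qed.

Lemma lca_le_trans a1 a2 a3 : lca_le a1 a2 -> lca_le a2 a3 -> lca_le a1 a3.
Proof.
by move=> [r12 b12] [r23 b23]; split=> [F G /r23/r12|F /b23/b12].
Qed.

Lemma lca_le_anti a1 a2 : lca_le a1 a2 -> lca_le a2 a1 -> a1 = a2.
Proof.
move=> [r12 b12] [r21 b21].
have rE : lca_rel a1 = lca_rel a2.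
  by apply/funext => F; apply/funext => G; apply/propext; split=> [/r21|/r12].
have bE : lca_bounded a1 = lca_bounded a2 by exact/seteqP.
case: a1 rE bE {r12 b12 r21 b21} => r1 b1 p1 p2 p3 p4 /= rE bE.
subst r1 b1; case: a2 p1 p2 p3 p4 => r2 b2 q1 q2 q3 q4 /= *.
by congr AdmissibleLCA; exact: Prop_irrelevance.
Qed.

End AdmissibleOrder.

Definition poset_iso (P Q : Type) (leP : P -> P -> Prop) (leQ : Q -> Q -> Prop)
    (mu : P -> Q) : Prop :=
  bijective mu /\ forall x y, leP x y <-> leQ (mu x) (mu y).

(* Main.v *)
Require Import Defs.
From HB Require Import structures.
From mathcomp Require Import all_boot all_order.
From mathcomp Require Import boolp classical_sets functions filter topology.

(** Both posets are compared through one construction. An extension [(Y, f)] of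
    [X] induces on the regular closed sets of [X] the relation
    cl f(F) meets cl f(G), together with the ideal of those [F] for which
    cl f(F) is compact; this is an admissible local contact algebra
    ([lca_of_ext]), the interpolation and density axioms being the separation
    properties of the locally compact Hausdorff space [Y].

    The order is preserved because a continuous map of extensions carries
    closures into closures. It is reflected ([lca_le_ext]) because a smaller
    contact relation and a smaller ideal are exactly what is needed to extend
    [f1] continuously over [Y2]: near a point [y] of [Y2] the values of [f1] lie
    in a compact set by the comparison of ideals, hence accumulate at some [z],
    and they converge to [z] because sets that are far apart around [z] in [Y1]
    are far apart in [Y2]. As the order on extensions is antisymmetric up to
    equivalence, injectivity follows.

    For surjectivity ([lca_of_ends]), a space is rebuilt from the algebra. Its
    points are the ends ([is_end]): an end [p] plays the role of the set of all
    [F] whose closure in the extension is a neighbourhood of [p]. The sets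
    [end_nbhd F] of ends containing [F] are a base of the topology, and
    [end_closed F], the set of ends omitting the complement of [F], turns out
    to be the closure of [F] ([ends_closure]). Two facts carry the proof. The
    set [end_closed K] is compact for bounded [K], since an ultrafilter
    containing it converges to an explicit end ([ultra_end]). And if
    [end_closed F] is compact and [F] lies outside an ideal, then some end in
    [end_closed F] avoids the ideal ([end_avoid_ideal]); applied to the bounded
    elements it recovers the ideal of the algebra, and applied to the elements
    far from [G] it recovers the contact relation. *)

Set Implicit Arguments.
Unset Strict Implicit.
Unset Printing Implicit Defensive.

Import Order.TTheory Order.CTheory.

Local Open Scope classical_set_scope.

(** * Separation in locally compact Hausdorff spaces *)

Section Topology.
Context {T : topologicalType}.
Implicit Types (A K U V : set T) (D : set_system T).

(** Compactness as an induction principle: otherwise the sets [K `\` V] with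
    [V] in [D] generate a proper filter on [K], which cannot have a cluster
    point. *)
Lemma compact_directed K D : compact K ->
    D set0 -> (forall V W, D V -> D W -> D (V `|` W)) ->
    (forall x, K x -> exists2 V, D V & nbhs x V) ->
  exists2 V, D V & K `<=` V.
Proof.
move=> cK D0 DU Dnbhs; apply: contrapT => noV.
pose F := filter_from D (fun V => K `\` V).
have FF : ProperFilter F.
  apply: filter_from_proper; last first.
    move=> V DV; apply/set0P/eqP ; rewrite setD_eq0 => KV.
    by apply: noV; exists V.
  apply: filter_from_filter; first by exists set0.
  move=> V W DV DW; exists (V `|` W); first exact: DU.
  by move=> x [Kx nVW]; split; split=> // ?; apply: nVW; [left|right].
have [|x [Kx clx]] := cK F FF; first by exists set0 => // x [].
have [V DV Vx] := Dnbhs x Kx.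
have FV : F (K `\` V) by exists V.
by have [y [[_ nVy] Vy]] := clx _ _ FV Vx.
Qed.

Hypotheses (lcT : locally_compact [set: T]) (hT : hausdorff_space T).

Lemma lch_shrink_point x U : nbhs x U ->
  exists V, [/\ open V, V x, closure V `<=` U & compact (closure V)].
Proof.
move=> Ux; have := @lcT x I; rewrite withinET => -[K Kx [cK clK]].
have UKx : nbhs x (U `&` K) by exact: filterI.
have [W Wx WUK] := compact_regular hT cK Kx UKx.
have clW : closure W° `<=` U `&` K.
  exact: subset_trans (closureS (@interior_subset _ _)) WUK.
exists W°; split; [exact: open_interior| | |].
- exact: nbhs_singleton (nbhs_interior Wx).
- by move=> y /clW[].
- by apply: (subclosed_compact _ cK) => [|y /clW[]]//; exact: closed_closure.
Qed.

Lemma lch_shrink K U : compact K -> open U -> K `<=` U ->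
  exists V, [/\ open V, K `<=` V, closure V `<=` U & compact (closure V)].
Proof.
move=> cK oU KU.
pose D := [set V | [/\ open V, closure V `<=` U & compact (closure V)]].
have [] := @compact_directed K D cK.
- by split; [exact: open0 | rewrite closure0 | rewrite closure0; exact: compact0].
- move=> V W [oV VU cV] [oW WU cW]; split; first exact: openU.
    by rewrite closureU subUset.
  by rewrite closureU; exact: compactU.
- move=> x /KU Ux.
  have [V [oV Vx VU cV]] := lch_shrink_point (open_nbhs_nbhs (conj oU Ux)).
  by exists V => //; exact: open_nbhs_nbhs.
by move=> V [oV VU cV] KV; exists V.
Qed.

End Topology.

(** * Contact algebras *)

Section ContactTheory.
Context {d : Order.disp_t} {B : ctbDistrLatticeType d} {rho : B -> B -> Prop}.
Hypothesis rhoC : contact_algebra rho.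
Implicit Types a b c : B.
Local Open Scope order_scope.
Local Notation "a ≪ b" := (nontangential rho a b) (at level 70).

Lemma contactS a b a' b' : a <= a' -> b <= b' -> rho a b -> rho a' b'.
Proof.
have contactSr c1 c2 c : c1 <= c2 -> rho c c1 -> rho c c2.
  by move=> /join_r <- cc1; apply/(contact_join rhoC); left.
move=> aa' bb' /(contactSr _ _ _ bb')/(contact_sym rhoC).
by move=> /(contactSr _ _ _ aa')/(contact_sym rhoC).
Qed.

Lemma ntangS a b a' b' : a' <= a -> b <= b' -> a ≪ b -> a' ≪ b'.
Proof.
by move=> aa' bb' ab h; apply: ab; apply: contactS h; rewrite ?leC.
Qed.

Lemma ntang_le a b : a ≪ b -> a <= b.
Proof.
move=> ab; apply: contrapT => nab; apply: ab.
have : rho (a `&` ~` b) (a `&` ~` b).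
  by apply: (contact_refl rhoC) => /eqP; rewrite disj_leC complK.
by apply: contactS; [exact: leIl | exact: leIr].
Qed.

Lemma ntangC a b : a ≪ b -> ~` b ≪ ~` a.
Proof.
by rewrite /nontangential complK; apply: contra_not => /(contact_sym rhoC).
Qed.

Lemma ntang_meet a a' b b' : a ≪ b -> a' ≪ b' -> a `&` a' ≪ b `&` b'.
Proof.
move=> ab a'b'; rewrite /nontangential complI => /(contact_join rhoC)[].
  by move=> h; apply: ab; apply: contactS h => //; exact: leIl.
by move=> h; apply: a'b'; apply: contactS h => //; exact: leIr.
Qed.

Lemma ntang_top a : a ≪ \top.
Proof.
move=> /(contact_neq0 rhoC)[_]; apply; apply/eqP.
by rewrite -lex0 leCx lex1.
Qed.

Lemma ntang_bot a : a ≪ \bot -> a = \bot.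
Proof. by move=> /ntang_le; rewrite lex0 => /eqP. Qed.

Lemma lattice_ideal_far b : lattice_ideal [set a | ~ rho a b].
Proof.
split=> [/(contact_neq0 rhoC)[]//|a a' aa' + h|a a' ab a'b].
  by apply; exact: contactS h.
move=> /(contact_sym rhoC)/(contact_join rhoC).
by case=> /(contact_sym rhoC).
Qed.

End ContactTheory.

(** * Regular closed sets *)

Section RegularHull.
Context {X : topologicalType}.
Implicit Types (A : set X) (F G : RC X).

Definition rc_hull A : RC X := MkRC (regclosed_meet A).

Lemma rc_hullE A : open A -> rc_hull A = closure A :> set X.
Proof. by move=> /interior_id /= ->. Qed.

Lemma sub_rc_hull A : open A -> A `<=` rc_hull A.
Proof. by move=> oA; rewrite rc_hullE//; exact: subset_closure. Qed.

Lemma rc_compl_sub F : ~` F `<=` (~` F)%O.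
Proof. exact: subset_closure. Qed.

Lemma rc_complP F x : rcset (~` F)%O x <-> ~ (F : set X)° x.
Proof. by rewrite rc_complE closure_setC. Qed.

Lemma interior_meet_rc F G : F° `&` G° `<=` (rcset (F `&` G)%O)°.
Proof.
rewrite -interiorI => x /nbhs_interior; apply: filterS.
exact: subset_closure.
Qed.

Lemma rc_interior_neq0 F : F !=set0 -> F° !=set0.
Proof.
move=> /set0P F0; apply/set0P; apply: contra_neq F0 => i0.
by rewrite -(rcsetP F) i0 closure0.
Qed.

Lemma rc_neq0 F : F <> \bot%O -> F !=set0.
Proof. by move=> F0; apply/set0P/eqP => E; apply: F0; exact: rc_ext. Qed.

Lemma rc_nonbot F x : rcset F x -> F <> \bot%O.
Proof. by move=> Fx F0; rewrite F0 in Fx. Qed.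

Lemma compact_rc_nbhd x (U : set X) :
    locally_compact [set: X] -> hausdorff_space X -> nbhs x U ->
  exists K : RC X, [/\ (rcset K)° x, CR X K & K `<=` U].
Proof.
move=> lcX hX Ux; have [V [oV Vx VU cV]] := lch_shrink_point lcX hX Ux.
exists (rc_hull V); split; last by rewrite rc_hullE.
  by apply: (filterS (sub_rc_hull oV)); exact: open_nbhs_nbhs (conj oV Vx).
by move: cV; rewrite -(rc_hullE oV).
Qed.

End RegularHull.

(** * The local contact algebra of an extension *)

Section ExtensionAlgebra.
Context {X : topologicalType} (e : lch_extension X).
Implicit Types F G H : RC X.
Local Notation Y := (ext_space e).
Local Notation f := (@ext_map X e).

Definition ext_closure F : set Y := closure (f @` F).

Lemma ext_map_continuous : continuous f.
Proof. by have [] := ext_embedding e. Qed.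

Lemma open_preimage_ext V : open V -> open (f @^-1` V).
Proof. by move: V; apply/continuousP; exact: ext_map_continuous. Qed.

Lemma ext_map_closure F x : rcset F x -> ext_closure F (f x).
Proof. by move=> Fx; apply: subset_closure; exists x. Qed.

Lemma ext_closure_sub F A :
  closed A -> F `<=` f @^-1` A -> ext_closure F `<=` A.
Proof.
move=> /closure_id cA FA; rewrite cA; apply: closureS => _ [x Fx <-].
exact: FA.
Qed.

Lemma ext_closureS F G : F `<=` G -> ext_closure F `<=` ext_closure G.
Proof. by move=> FG; exact/closureS/image_subset. Qed.

Lemma ext_closure_bot : ext_closure \bot%O = set0.
Proof. by rewrite /ext_closure rc_botE image_set0 closure0. Qed.

Lemma ext_closureU F G :
  ext_closure (F `|` G)%O = ext_closure F `|` ext_closure G.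
Proof. by rewrite /ext_closure rc_joinE image_setU closureU. Qed.

(** [f] is an embedding, so the closure in [Y] adds to the closed set [F] only
    points outside [X]. *)
Lemma ext_closure_map F x : ext_closure F (f x) -> rcset F x.
Proof.
move=> Fx; apply: contrapT => nFx; have [fI _ fo] := ext_embedding e.
have [V oV fV] := fo _ (closed_openC (@rc_closed _ F)).
have [Vx _] : (V `&` range f) (f x) by rewrite -fV; exists x.
have [_ [[z Fz <-] Vz]] := Fx _ (open_nbhs_nbhs (conj oV Vx)).
have : (f @` (~` F)) (f z) by rewrite fV; split=> //; exists z.
by move=> [z' nFz' /fI zE]; apply: nFz'; rewrite zE.
Qed.

(** As [F] is the closure of its interior, interior points suffice to
    approximate its closure in [Y]. *)
Lemma ext_closure_interior F y V : ext_closure F y -> nbhs y V ->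
  exists2 x, F° x & V (f x).
Proof.
move=> Fy /nbhs_interior Vy; have [_ [[x Fx <-] Vx]] := Fy _ Vy.
rewrite -(rcsetP F) in Fx.
have [z [Fz Vz]] := Fx _ (ext_map_continuous Vx).
by exists z => //; exact: interior_subset.
Qed.

(** This and [ext_closure_hullC] let the traces on [X] of open sets of [Y]
    stand for them in the algebra: they turn separation in [Y] into the
    nontangential relation. *)
Lemma ext_closure_hull V : open V ->
  ext_closure (rc_hull (f @^-1` V)) `<=` closure V.
Proof.
move=> oV; apply: ext_closure_sub; first exact: closed_closure.
rewrite rc_hullE; last exact: open_preimage_ext.
have /closure_id -> : closed (f @^-1` closure V).
  move/continuous_closedP: ext_map_continuous; apply; exact: closed_closure.
by apply: closureS => x; exact: (@subset_closure _ V).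
Qed.

Lemma ext_closure_avoid F V : open V -> V `&` (f @` F) = set0 ->
  ext_closure F `&` V = set0.
Proof.
move=> oV VF; rewrite -subset0 => y [Fy Vy].
have [z [Fz Vz]] := Fy _ (open_nbhs_nbhs (conj oV Vy)).
have : (V `&` f @` F) z by [].
by rewrite VF.
Qed.

Lemma ext_hull_interior V x : open V -> V (f x) -> (rc_hull (f @^-1` V))° x.
Proof.
move=> oV Vx; have oW := open_preimage_ext oV.
apply: (filterS (sub_rc_hull oW)).
exact: open_nbhs_nbhs (conj oW Vx).
Qed.

Lemma ext_closure_hullC V : open V ->
  ext_closure (~` rc_hull (f @^-1` V))%O `&` V = set0.
Proof.
move=> oV; apply: ext_closure_avoid => //; rewrite -subset0 => y [Vx [x Cx xE]].
rewrite -xE in Vx; move/rc_complP: Cx; apply.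
exact: ext_hull_interior.
Qed.

Lemma ext_image_compact F : compact F -> compact (f @` F).
Proof.
by apply: continuous_compact; exact/continuous_subspaceT/ext_map_continuous.
Qed.

Lemma ext_closure_compact F : compact F -> ext_closure F = f @` F.
Proof.
move=> /ext_image_compact cF; apply/esym/(closure_id _).1.
exact: compact_closed (@ext_hausdorff X e) cF.
Qed.

Definition ext_rel F G := ext_closure F `&` ext_closure G !=set0.
Definition ext_bounded := [set F | compact (ext_closure F)].

Lemma ext_ntangP F G : nontangential ext_rel F G <->
  ext_closure F `<=` ~` ext_closure (~` G)%O.
Proof.
rewrite -disjoints_subset; split=> [/set0P/negP/negPn/eqP//|FG].
by move=> [y]; rewrite FG.
Qed.

Let lcY := @ext_locally_compact X e.
Let hY := @ext_hausdorff X e.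

Lemma ext_contact_algebra : contact_algebra ext_rel.
Proof.
split.
- by move=> F /rc_neq0[x Fx]; exists (f x); split; exact: ext_map_closure.
- by move=> F G [y [Fy Gy]]; split=> E; rewrite E ext_closure_bot in Fy Gy.
- by move=> F G [y [Fy Gy]]; exists y.
- move=> F G H; rewrite /ext_rel ext_closureU setIUr.
  split; first by move=> [y [|]]; [left|right]; exists y.
  by move=> [] [y ?]; exists y; [left|right].
Qed.

Lemma ext_bounded_ideal : lattice_ideal ext_bounded.
Proof.
split; rewrite /ext_bounded /=.
- by rewrite ext_closure_bot; exact: compact0.
- move=> F G /rc_leP FG cG; apply: (subclosed_compact _ cG).
    exact: closed_closure.
  exact: ext_closureS.
- by move=> F G cF cG; rewrite ext_closureU; exact: compactU.
Qed.

Lemma ext_hull_bounded V : open V -> compact (closure V) ->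
  ext_bounded (rc_hull (f @^-1` V)).
Proof.
move=> oV cV; apply: (subclosed_compact _ cV); first exact: closed_closure.
exact: ext_closure_hull.
Qed.

(** Each axiom comes from an open set [V] of [Y] with compact closure, whose
    trace on [X] is then bounded. For interpolation, [V] lies between the
    closure of [F] and the complement of the closure of the complement of [G];
    for locality, it is a neighbourhood of a point common to the two closures;
    for density, its closure lies in an open set that cuts out of [X] the
    interior of [F]. *)
Lemma ext_local_contact_algebra : local_contact_algebra ext_rel ext_bounded.
Proof.
split; [exact: ext_contact_algebra|exact: ext_bounded_ideal| | | ].
- move=> F G bF /ext_ntangP FG.
  have oU := closed_openC (@closed_closure _ (f @` (~` G)%O)).
  have [V [oV FV VG cV]] := lch_shrink lcY hY bF oU FG.
  exists (rc_hull (f @^-1` V)); first exact: ext_hull_bounded.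
  split; apply/ext_ntangP.
    move=> y /FV Vy Cy.
    by have : (set0 : set Y) y by rewrite -(ext_closure_hullC oV).
  exact: subset_trans (ext_closure_hull oV) VG.
- move=> F G [y [Fy Gy]].
  have [V [oV Vy _ cV]] := lch_shrink_point lcY hY (@filterT _ (nbhs y) _).
  exists (rc_hull (f @^-1` V)); first exact: ext_hull_bounded.
  exists y; split=> // U Uy.
  have [x Gx [Ux Vx]] : exists2 x, G° x & (U `&` V) (f x).
    apply: (ext_closure_interior Gy); apply: filterI => //.
    exact: open_nbhs_nbhs.
  exists (f x); split=> //; exists x => //.
  have HGx : ((rc_hull (f @^-1` V))° `&` G°) x.
    by split=> //; exact: ext_hull_interior.
  exact: interior_subset (interior_meet_rc HGx).
- move=> F /rc_neq0/rc_interior_neq0[x Fx].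
  have [fI _ fo] := ext_embedding e.
  have [W oW fW] := fo _ (@open_interior _ F).
  have [Wx _] : (W `&` range f) (f x) by rewrite -fW; exists x.
  have [V [oV Vx VW cV]] :=
    lch_shrink_point lcY hY (open_nbhs_nbhs (conj oW Wx)).
  exists (rc_hull (f @^-1` V)); split; first exact: ext_hull_bounded.
    exact: rc_nonbot (interior_subset (ext_hull_interior oV Vx)).
  apply/ext_ntangP; apply: subset_trans (ext_closure_hull oV) _.
  apply: (subset_trans VW); rewrite -disjoints_subset setIC.
  apply: ext_closure_avoid => //; rewrite -subset0 => y [Wy [z Cz zE]].
  have : (f @` F°) (f z) by rewrite fW zE; split=> //; exists z.
  by move=> [z' Fz' /fI z'E]; move/rc_complP: Cz; apply; rewrite -z'E.
Qed.

Lemma ext_rel_meet F G : F `&` G !=set0 -> ext_rel F G.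
Proof. by move=> [x [Fx Gx]]; exists (f x); split; exact: ext_map_closure. Qed.

Lemma ext_compact_bounded : CR X `<=` ext_bounded.
Proof.
move=> F cF; rewrite /ext_bounded /= ext_closure_compact//.
exact: ext_image_compact.
Qed.

Lemma ext_rel_compact F G : CR X G -> ext_rel F G -> F `&` G !=set0.
Proof.
move=> cG [y [Fy]]; rewrite ext_closure_compact// => -[x Gx xy].
by exists x; split=> //; apply: ext_closure_map; rewrite xy.
Qed.

Definition lca_of_ext : admissible_lca X :=
  AdmissibleLCA ext_local_contact_algebra ext_rel_meet ext_compact_bounded
    ext_rel_compact.

End ExtensionAlgebra.

(** * Comparison of extensions *)

Section ExtensionOrder.
Context {X : topologicalType}.
Implicit Types (e : lch_extension X) (F G : RC X).

Lemma ext_le_lca e1 e2 :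
  ext_le e1 e2 -> lca_le (lca_of_ext e1) (lca_of_ext e2).
Proof.
move=> [h hc hE].
have hF F y : ext_closure F y -> ext_closure F (h y).
  move=> Fy U /hc/Fy[_ [[x Fx <-] Ux]].
  by exists (h (@ext_map X e2 x)); split=> //; exists x => //; rewrite hE.
split=> [F G [y [Fy Gy]]|F cF]; first by exists (h y); split; exact: hF.
have chF : compact (h @` ext_closure F).
  by apply: continuous_compact cF; exact: continuous_subspaceT.
apply: (subclosed_compact _ chF); first exact: closed_closure.
apply: ext_closure_sub; first exact: compact_closed (@ext_hausdorff X e1) chF.
move=> x Fx; exists (@ext_map X e2 x); first exact: ext_map_closure.
by rewrite hE.
Qed.

Section Extend.
Variables e1 e2 : lch_extension X.
Local Notation f1 := (@ext_map X e1).
Local Notation f2 := (@ext_map X e2).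
Let lcY := @ext_locally_compact X e1.
Let hY := @ext_hausdorff X e1.
Implicit Types (y : ext_space e2) (z : ext_space e1).

(** [f1] tends to [z] along the filter of traces on [X] of the neighbourhoods
    of [y]. *)
Definition trace_cvg y z := forall W, nbhs z W ->
  exists2 V, nbhs y V & f2 @^-1` V `<=` f1 @^-1` W.

Lemma trace_cvg_closure y z V A : trace_cvg y z -> nbhs y V ->
  f2 @^-1` V `<=` f1 @^-1` A -> closure A z.
Proof.
move=> yz /nbhs_interior Vy VA W /yz[U /nbhs_interior Uy UW].
have [//||t [[Vt Ut] [x _ xt]]] := @ext_dense X e2 (V° `&` U°).
- by exists y; split; exact: nbhs_singleton.
- by apply: openI; exact: open_interior.
exists (f1 x); split.
  by apply: VA; rewrite /= xt; exact: interior_subset.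
by apply: UW; rewrite /= xt; exact: interior_subset.
Qed.

Lemma trace_cvg_map x : trace_cvg (f2 x) (f1 x).
Proof.
move=> W /(@ext_map_continuous X e1)/nbhs_interior Wx.
have [fI _ fo] := ext_embedding e2.
have [V oV fV] := fo _ (@open_interior _ (f1 @^-1` W)).
have [Vx _] : (V `&` range f2) (f2 x).
  by rewrite -fV; exists x => //; exact: nbhs_singleton.
exists V; first exact: open_nbhs_nbhs.
move=> t Vt; have [t' Wt' /fI <-] : (f2 @` (f1 @^-1` W)°) (f2 t).
  by rewrite fV; split=> //; exists t.
exact: interior_subset Wt'.
Qed.

Lemma trace_cvg_unique y z z' : trace_cvg y z -> trace_cvg y z' -> z = z'.
Proof.
move=> yz yz'; apply: hY => U V Uz Vz'.
have [A Ay AU] := yz _ Uz; exact: (trace_cvg_closure yz' Ay AU).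
Qed.

Hypothesis le12 : lca_le (lca_of_ext e1) (lca_of_ext e2).

(** A cluster point [z] of the values of [f1] near [y] exists because a bounded
    neighbourhood of [y] is also bounded in [Y1]. To see that it is a limit,
    choose [W'] with closure in the given [W], then [U] with closure in [W'],
    both open around [z]. The trace of [U] is far from the complement of the trace
    of [W'] in [Y1], so also in [Y2]; since [y] is in the closure of the
    former, it has a neighbourhood that avoids the latter. *)
Lemma trace_cvg_exists y : exists z, trace_cvg y z.
Proof.
have [r21 b21] := le12.
have [V0 [oV0 V0y _ cV0]] :=
  lch_shrink_point (@ext_locally_compact X e2) (@ext_hausdorff X e2)
    (@filterT _ (nbhs y) _).
pose H := rc_hull (f2 @^-1` V0).
have bH : compact (ext_closure (e := e1) H) := b21 _ (ext_hull_bounded oV0 cV0).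
pose Phi : set_system (ext_space e1) :=
  filter_from (nbhs y) (fun V => f1 @` (f2 @^-1` V)).
have PF : ProperFilter Phi.
  apply: filter_from_proper; last first.
    move=> V /nbhs_interior Vy.
    have [||t [Vt [x _ xt]]] := @ext_dense X e2 V°.
    - by exists y; exact: nbhs_singleton.
    - exact: open_interior.
    by exists (f1 x), x => //=; rewrite xt; exact: interior_subset.
  apply: filter_from_filter; first by exists setT; exact: filterT.
  move=> V W Vy Wy; exists (V `&` W); first exact: filterI.
  by move=> _ [x [Vx Wx] <-]; split; exists x.
have PH : Phi (ext_closure (e := e1) H).
  exists V0; first exact: open_nbhs_nbhs.
  move=> _ [x V0x <-]; apply: ext_map_closure.
  by apply: sub_rc_hull => //; exact: open_preimage_ext.
have [z [_ clz]] := bH _ _ PH; exists z => W Wz.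
have [W' [oW' W'z W'W _]] := lch_shrink_point lcY hY Wz.
have [U [oU Uz UW' _]] :=
  lch_shrink_point lcY hY (open_nbhs_nbhs (conj oW' W'z)).
pose G := rc_hull (f1 @^-1` W'); pose K := rc_hull (f1 @^-1` U).
have nKG : ~ ext_rel e1 K (~` G)%O.
  move=> [t [/(ext_closure_hull oU)/UW' W't Gt]].
  have : (ext_closure (~` G)%O `&` W') t by [].
  by rewrite ext_closure_hullC.
have Ky : ext_closure (e := e2) K y.
  move=> V Vy; have PV : Phi (f1 @` (f2 @^-1` V)) by exists V.
  have [_ [[x Vx <-] Ux]] := clz _ _ PV (open_nbhs_nbhs (conj oU Uz)).
  exists (f2 x); split=> //; exists x => //.
  by apply: sub_rc_hull => //; exact: open_preimage_ext.
exists (~` ext_closure (e := e2) (~` G)%O).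
  apply: open_nbhs_nbhs; split; first exact/closed_openC/closed_closure.
  by move=> Gy; apply: nKG; apply: r21; exists y.
move=> x nGx; apply: W'W; apply: (ext_closure_hull oW').
apply: ext_map_closure; apply: contrapT => nGx'; apply: nGx.
exact/ext_map_closure/rc_compl_sub.
Qed.

Lemma lca_le_ext : ext_le e1 e2.
Proof.
have [h hP] := choice trace_cvg_exists; exists h; last first.
  apply/funext => x; apply: (@trace_cvg_unique (f2 x)); last exact: hP.
  exact: trace_cvg_map.
move=> y W Wy; have [W' [oW' W'y W'W _]] := lch_shrink_point lcY hY Wy.
have [V /nbhs_interior Vy VW] := hP _ _ (open_nbhs_nbhs (conj oW' W'y)).
apply: filterS Vy => y' Vy'; apply: W'W.
exact: trace_cvg_closure (hP y') Vy' VW.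
Qed.

End Extend.
End ExtensionOrder.

(** * The space of ends of an admissible algebra *)

Section Ends.
Context {X : topologicalType} (L : admissible_lca X).
Implicit Types (F G H K : RC X).
Local Notation rho := (lca_rel L).
Local Notation bounded := (lca_bounded L).
Local Notation "F ≪ G" := (nontangential rho F G) (at level 70).

Let rhoC : contact_algebra rho := lca_contact (lca_axioms L).
Let bndI : lattice_ideal bounded := lca_ideal (lca_axioms L).

(** A point [p] of an extension is recorded as the set of all [F] whose closure
    in the extension is a neighbourhood of [p]. Roundness says that such
    neighbourhoods can be shrunk to bounded ones, as in a locally compact
    space. Primality is the form that maximality takes: when a bounded [F] is
    strictly inside [G], every point is interior to the closure of the
    complement of [F] or to that of [G]. *)
Record is_end (p : set (RC X)) : Prop := IsEnd {
  end_top : p \top%O;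
  end_bot : ~ p \bot%O;
  end_le : forall F G, (F <= G)%O -> p F -> p G;
  end_meet : forall F G, p F -> p G -> p (F `&` G)%O;
  end_round : forall F, p F -> exists G, [/\ p G, bounded G & G ≪ F];
  end_prime : forall F G, bounded F -> F ≪ G -> p (~` F)%O \/ p G }.

Record lca_end := LcaEnd { end_set :> set (RC X); endP : is_end end_set }.

HB.instance Definition _ := gen_eqMixin lca_end.
HB.instance Definition _ := gen_choiceMixin lca_end.

Implicit Types p q : lca_end.

Lemma end_ext p q : p = q :> set (RC X) -> p = q.
Proof.
case: p q => [p pP] [q qP] /= pq; case: _ / pq qP => qP.
by congr LcaEnd; exact: Prop_irrelevance.
Qed.

Definition end_nbhd F : set lca_end := [set p | end_set p F].

Definition end_open (U : set lca_end) : Prop :=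
  forall p, U p -> exists2 F, end_set p F & end_nbhd F `<=` U.

Lemma end_nbhd_meet F G : end_nbhd (F `&` G)%O = end_nbhd F `&` end_nbhd G.
Proof.
apply/seteqP; split=> p /=.
  by move=> pFG; split; apply: (end_le (endP p)) pFG; [exact: leIl|exact: leIr].
by move=> [pF pG]; exact: (end_meet (endP p)).
Qed.

Lemma end_openT : end_open setT.
Proof. by move=> p _; exists \top%O => //; exact: (end_top (endP p)). Qed.

Lemma end_openI : setI_closed end_open.
Proof.
move=> U V oU oV p [/oU[F pF FU] /oV[G pG GV]].
exists (F `&` G)%O; first exact: (end_meet (endP p)).
by rewrite end_nbhd_meet; exact: setISS.
Qed.

Lemma end_open_bigU (I : Type) (U : I -> set lca_end) :
  (forall i, end_open (U i)) -> end_open (\bigcup_i U i).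
Proof.
move=> oU p [i _ /oU[F pF FU]]; exists F => //.
by apply: (subset_trans FU) => q Uq; exists i.
Qed.

HB.instance Definition _ :=
  isOpenTopological.Build lca_end end_openT end_openI end_open_bigU.

Lemma open_endE (U : set lca_end) : open U = end_open U. Proof. by []. Qed.

Lemma open_end_nbhd F : open (end_nbhd F).
Proof. by rewrite open_endE => p pF; exists F. Qed.

Lemma nbhs_endP p (U : set lca_end) :
  nbhs p U <-> exists2 F, end_set p F & end_nbhd F `<=` U.
Proof.
split=> [|[F pF FU]].
  rewrite nbhsE => -[V [+ Vp] VU]; rewrite open_endE => oV.
  by have [F pF FV] := oV p Vp; exists F => //; exact: subset_trans VU.
by exists (end_nbhd F); split=> // q qF; exists F.
Qed.

Lemma nbhs_end p F : end_set p F -> nbhs p (end_nbhd F).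
Proof. by move=> pF; apply/nbhs_endP; exists F. Qed.

Lemma end_complN p F : end_set p F -> ~ end_set p (~` F)%O.
Proof.
move=> pF pF'; apply: (end_bot (endP p)); rewrite -(meetxC F).
exact: (end_meet (endP p)).
Qed.

Definition end_closed F : set lca_end := [set p | ~ end_set p (~` F)%O].

Lemma closed_end_closed F : closed (end_closed F).
Proof. by rewrite -openC setCK; exact: open_end_nbhd. Qed.

Lemma end_nbhd_closed F : end_nbhd F `<=` end_closed F.
Proof. by move=> p; exact: end_complN. Qed.

Lemma end_closed_nbhd F G :
  bounded F -> F ≪ G -> end_closed F `<=` end_nbhd G.
Proof. by move=> bF FG p; case: (end_prime (endP p) bF FG). Qed.

Lemma end_closedS F G : (F <= G)%O -> end_closed F `<=` end_closed G.
Proof.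
move=> FG p pF pG; apply: pF; apply: (end_le (endP p)) pG.
by rewrite leC.
Qed.

(** Suppose the neighbourhoods of [p] and [q] meet pairwise, and let [F] be in
    [p]. For a bounded [G] in [p] strictly inside [F], primality puts [F] or the
    complement of [G] in [q]; the latter would give disjoint neighbourhoods. *)
Lemma ends_hausdorff : hausdorff_space lca_end.
Proof.
have sub p q : cluster (nbhs p) q -> p `<=` q.
  move=> pq F pF; have [G [pG bG GF]] := end_round (endP p) pF.
  apply: (end_closed_nbhd bG GF) => qG.
  by have [r [/end_complN]] := pq _ _ (nbhs_end pG) (nbhs_end qG).
move=> p q pq; apply: end_ext; apply/seteqP; split; apply: sub => //.
by move=> U V Uq Vp; rewrite setIC; exact: pq.
Qed.

Section UltraLimit.
Variables (U : set_system lca_end) (UU : UltraFilter U).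

(** The limit of the ultrafilter [U]. The gap between [G] and [F] is what makes
    it round. *)
Definition ultra_end : set (RC X) :=
  [set F | exists G, [/\ bounded G, U (end_nbhd G) & G ≪ F]].

(** Roundness is interpolation. For primality of [F] inside [G], interpolate
    twice: if the outer interpolant [F2] is not in [U], then [U] contains the
    complement of the inner one [F1], which is strictly inside the complement
    of [F]; the intersection with [H] makes it bounded. *)
Lemma ultra_end_is_end K : bounded K -> U (end_closed K) -> is_end ultra_end.
Proof.
move=> bK UK.
have interp := lca_interp (lca_axioms L).
have [H bH [KH _]] := interp _ _ bK (@ntang_top _ _ _ rhoC K).
have UH : U (end_nbhd H) by apply: filterS UK; exact: end_closed_nbhd.
split.
- by exists H; split=> //; exact: ntang_top.
- move=> [G [bG UG /(ntang_bot rhoC) G0]].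
  apply: (filter_not_empty U); apply: filterS UG => p; rewrite G0.
  exact: (end_bot (endP p)).
- move=> F G FG [J [bJ UJ JF]]; exists J; split=> //.
  by apply: (ntangS rhoC _ FG) JF; exact: lexx.
- move=> F G [J [bJ UJ JF]] [J' [bJ' UJ' J'G]]; exists (J `&` J')%O; split.
  + by apply: (ideal_le bndI) bJ; exact: leIl.
  + by rewrite end_nbhd_meet; exact: filterI.
  + exact: ntang_meet.
- move=> F [J [bJ UJ JF]]; have [G bG [JG GF]] := interp _ _ bJ JF.
  by exists G; split=> //; exists J.
- move=> F G bF FG; have [F1 bF1 [FF1 F1G]] := interp _ _ bF FG.
  have [F2 bF2 [F12 F2G]] := interp _ _ bF1 F1G.
  have [UF|UF] := in_ultra_setVsetC (end_nbhd F2) UU.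
    by right; exists F2.
  left; exists (H `&` ~` F1)%O; split.
  + by apply: (ideal_le bndI) bH; exact: leIl.
  + rewrite end_nbhd_meet; apply: filterI => //; apply: filterS UF => p nF2.
    apply: contrapT => nF1; apply: nF2.
    exact: (end_closed_nbhd bF1 F12).
  + apply: (ntangS rhoC (leIr _ _) (lexx _)); exact: ntangC.
Qed.

End UltraLimit.

Lemma end_closed_compact K : bounded K -> compact (end_closed K).
Proof.
move=> bK; rewrite compact_ultra => U UU UK.
pose p := LcaEnd (ultra_end_is_end UU bK UK).
have pU F : end_set p F -> U (end_nbhd F).
  move=> [G [bG UG /(ntang_le rhoC) GF]]; apply: filterS UG => q.
  exact: (end_le (endP q)).
exists p; split.
  move=> /pU UK'; apply: (filter_not_empty U).
  by apply: filterS (filterI UK UK') => q [].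
by move=> V /nbhs_endP[F /pU UF FV]; apply: filterS UF.
Qed.

Lemma end_bounded p : exists2 F, end_set p F & bounded F.
Proof.
by have [F [pF bF _]] := end_round (endP p) (end_top (endP p)); exists F.
Qed.

Lemma ends_locally_compact : locally_compact [set: lca_end].
Proof.
move=> p _; rewrite withinET; have [F pF bF] := end_bounded p.
exists (end_closed F).
  by apply: filterS (nbhs_end pF); exact: end_nbhd_closed.
by split; [exact: end_closed_compact|exact: closed_end_closed].
Qed.

Hypotheses (lcX : locally_compact [set: X]) (hausX : hausdorff_space X).

Lemma rc_ntang_interior F G : F ≪ G -> F `<=` G°.
Proof.
move=> FG x Fx; apply: contrapT => /rc_complP Gx; apply: FG.
by apply: lca_meet; exists x.
Qed.

(** Between a compact set and any other, the relation of an admissible algebra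
    is the topological one; this is what places [X] inside the space of
    ends. *)
Lemma rc_interior_ntang F G : CR X F -> F `<=` G° -> F ≪ G.
Proof.
move=> cF FG /(contact_sym rhoC)/(lca_compact_meet cF)[x [/rc_complP nGx Fx]].
by apply: nGx; exact: FG.
Qed.

Definition point_end_set (x : X) : set (RC X) := [set F | (rcset F)° x].

Lemma point_is_end x : is_end (point_end_set x).
Proof.
split.
- exact: filterT.
- by move/interior_subset.
- by move=> F G /rc_leP FG; exact: interiorS FG _.
- by move=> F G Fx Gx; apply: interior_meet_rc.
- move=> F /nbhs_interior/(compact_rc_nbhd lcX hausX)[K [Kx cK KF]].
  exists K; split=> //.
    exact: lca_compact.
  exact: rc_interior_ntang.
- move=> F G bF /rc_ntang_interior FG.
  have [Gx|nGx] := pselect ((rcset G)° x); [by right | left].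
  apply: (filterS (@subset_closure _ _)).
  apply: open_nbhs_nbhs; split; first exact/closed_openC/rc_closed.
  by move/FG.
Qed.

Definition point_end x := LcaEnd (point_is_end x).

Lemma point_end_continuous : continuous point_end.
Proof.
move=> x U /nbhs_endP[F Fx FU]; apply: filterS (nbhs_interior Fx) => y Fy.
exact: FU.
Qed.

Lemma point_end_embedding : embedding point_end.
Proof.
split; [|exact: point_end_continuous|].
  move=> x y xy; apply: hausX => U V Ux Vy.
  have [K [Kx _ KU]] := compact_rc_nbhd lcX hausX Ux.
  have Ky : end_set (point_end y) K by rewrite -xy.
  exists y; split; last exact: nbhs_singleton.
  by apply: KU; exact: interior_subset.
move=> U oU; exists [set p | exists2 F, end_set p F & F `<=` U].
  by rewrite open_endE => p [F pF FU]; exists F => // q qF; exists F.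
apply/seteqP; split=> [_ [x Ux <-]|q [[F Fx FU] [x _ xE]]].
  split; last by exists x.
  have [K [Kx _ KU]] :=
    compact_rc_nbhd lcX hausX (open_nbhs_nbhs (conj oU Ux)).
  by exists K.
by exists x => //; apply: FU; rewrite -xE in Fx; exact: interior_subset Fx.
Qed.

Lemma point_end_dense : dense (range point_end).
Proof.
move=> U [p Up]; rewrite open_endE => oU; have [F pF FU] := oU p Up.
have : F !=set0.
  by apply: rc_neq0 => F0; apply: (end_bot (endP p)); rewrite -F0.
move=> /rc_interior_neq0[x Fx]; exists (point_end x); split; last by exists x.
exact: FU.
Qed.

Definition ends_extension : lch_extension X :=
  LCHExtension ends_locally_compact ends_hausdorff point_end_embedding
    point_end_dense.

Lemma point_end_closed F x : end_closed F (point_end x) <-> rcset F x.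
Proof.
suff -> : rcset F x = (~` (rcset (~` F)%O)°) x by [].
by rewrite -closure_setC rc_complE (closure_setC (rcset F)) setCK rcsetP.
Qed.

Lemma ends_closure F :
  ext_closure (e := ends_extension) F = end_closed F.
Proof.
apply/seteqP; split.
  apply: ext_closure_sub; first exact: closed_end_closed.
  by move=> x /point_end_closed.
move=> p pF U /nbhs_endP[G pG GU].
have : (G `&` F)%O <> \bot%O.
  move/eqP; rewrite disj_leC => GF; apply: pF.
  exact: (end_le (endP p)) pG.
move=> /rc_neq0[x]; rewrite rc_meetE => clx.
have [y] : (rcset G `&` F)° !=set0.
  by have [y []] := clx _ (@filterT _ _ _); exists y.
rewrite interiorI => -[Gy Fy]; exists (point_end y); split; last exact: GU.
by exists y => //; exact: interior_subset.
Qed.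

(** The ideal is directed, so if every end of [end_closed F] contained one of
    its members, compactness would give one [G] in the ideal with
    [end_closed F] inside [end_closed G], hence [F <= G], and [F] would be in
    the ideal. *)
Lemma end_avoid_ideal (I : set (RC X)) F : lattice_ideal I -> ~ I F ->
  compact (end_closed F) ->
  exists2 p, end_closed F p & forall G, I G -> ~ end_set p G.
Proof.
move=> iI nIF cF; apply: contrapT => np.
pose D : set_system lca_end := [set V | exists2 G, I G & V `<=` end_closed G].
have [|V W [G IG VG] [H IH WH]|p pF|V [G IG VG] FV] :=
  compact_directed cF (D := D).
- by exists \bot%O => //; exact: ideal0.
- exists (G `|` H)%O; first exact: ideal_join.
  rewrite subUset; split.
    by apply: (subset_trans VG); apply: end_closedS; exact: leUl.
  by apply: (subset_trans WH); apply: end_closedS; exact: leUr.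
- have [G IG pG] : exists2 G, I G & end_set p G.
    apply: contrapT => nG; apply: np; exists p => // G IG pG.
    by apply: nG; exists G.
  exists (end_nbhd G); last exact: nbhs_end.
  by exists G => //; exact: end_nbhd_closed.
apply: nIF; apply: (ideal_le iI) IG; apply/rc_leP => x Fx.
by apply/point_end_closed/VG/FV/point_end_closed.
Qed.

Lemma ends_bounded F : compact (end_closed F) <-> bounded F.
Proof.
split=> [cF|]; last exact: end_closed_compact.
apply: contrapT => nF; have [p _ pn] := end_avoid_ideal bndI nF cF.
by have [G pG bG] := end_bounded p; exact: (pn G).
Qed.

Lemma ends_contact_bounded F G : bounded F -> rho F G ->
  end_closed F `&` end_closed G !=set0.
Proof.
move=> bF FG; have [p pF pn] :=
  end_avoid_ideal (lattice_ideal_far rhoC G) (fun n => n FG)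
    (end_closed_compact bF).
exists p; split=> // pG.
have [H [pH _ HG]] := end_round (endP p) pG; apply: (pn H) => //.
by rewrite /nontangential complK in HG.
Qed.

(** Locality reduces the existence of a common end to a bounded [F]. Conversely,
    if [F] and [G] are far, a bounded element [K] of a common end makes
    primality applicable to [K `&` F] strictly inside the complement of
    [G]. *)
Lemma ends_contact F G : end_closed F `&` end_closed G !=set0 <-> rho F G.
Proof.
split=> [[p [pF pG]]|FG]; last first.
  have [K bK] := lca_local (lca_axioms L) (contact_sym rhoC FG).
  move=> /(contact_sym rhoC) KFG.
  have [|p [pK pG]] := ends_contact_bounded _ KFG.
    by apply: (ideal_le bndI) bK; exact: leIl.
  by exists p; split=> //; apply: (end_closedS _ pK); exact: leIr.
apply: contrapT => nFG; have [K pK bK] := end_bounded p.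
have bKF : bounded (K `&` F)%O by apply: (ideal_le bndI) bK; exact: leIl.
have KFG : (K `&` F)%O ≪ (~` G)%O.
  rewrite /nontangential complK => KFG; apply: nFG.
  by apply: (contactS rhoC) KFG; [exact: leIr|exact: lexx].
have [pKF|//] := end_prime (endP p) bKF KFG.
apply: pF; apply: (end_le (endP p)) (end_meet (endP p) pK pKF).
by rewrite complI meetUr meetxC join0x leIr.
Qed.

Lemma lca_of_ends : lca_of_ext ends_extension = L.
Proof.
apply: lca_le_anti; split=> /=.
- by move=> F G /ends_contact; rewrite /ext_rel !ends_closure.
- by move=> F /ends_bounded; rewrite /ext_bounded /= ends_closure.
- by move=> F G; rewrite /ext_rel !ends_closure => /ends_contact.
- by move=> F; rewrite /ext_bounded /= ends_closure => /ends_bounded.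
Qed.

End Ends.

(** * The isomorphism *)

Definition lca_of_class (X : topologicalType) (c : ext_class X) :
    admissible_lca X :=
  lca_of_ext (projT1 (cid (class_ofP c))).

Lemma class_le_lca (X : topologicalType) (c1 c2 : ext_class X) :
  class_le c1 c2 <-> lca_le (lca_of_class c1) (lca_of_class c2).
Proof.
rewrite /lca_of_class; case: cid => e1 /= ->; case: cid => e2 /= ->.
rewrite class_leE; split; [exact: ext_le_lca | exact: lca_le_ext].
Qed.

Theorem theorem2p9 (X : topologicalType)
  (lcX : locally_compact [set: X]) (hausX : hausdorff_space X) :
  exists mu : ext_class X -> admissible_lca X,
    poset_iso (@class_le X) (@lca_le X) mu.
Proof.
exists (@lca_of_class X); split; last exact: class_le_lca.
pose nu L := class_of (ends_extension L lcX hausX).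
have nuK : cancel nu (@lca_of_class X).
  move=> L; rewrite /lca_of_class; case: cid => e /= /class_of_eq eE.
  rewrite -[RHS](lca_of_ends L lcX hausX).
  apply: lca_le_anti; apply/ext_le_lca/ext_equiv_le => //.
  exact: ext_equiv_sym.
exists nu => // c.
by apply: class_le_anti; apply/class_le_lca; rewrite nuK; exact: lca_le_refl.
Qed.
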